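(* The cusped soliton $u_{\rm cusp}$ represents the lowest energy state in the continuous family of solitary wave solutions $u_C$: for every $C\in\mathbb{R}$, $$E(u_{\rm cusp})\le E(u_C),\qquad E(\psi)=\int_{\mathbb{R}}|\psi_x|^2dx.$$
   Context: Cusped soliton $u_{\rm cusp}$: $u_{\rm cusp}(0)=1$ and for $x\ne0$, $u=u_{\rm cusp}(x)\in(0,1)$ is defined by $|x|=\int_u^1\frac{d\xi}{\sqrt{-\log(1-\xi^2)}}$. Solitary wave $u_C$, $C\in\mathbb{R}$: let $\ell_C:=\int_1^{\sqrt{1+e^{2C}}}\frac{du}{\sqrt{2C-\log(u^2-1)}}$ and $$u_C(x)=\begin{cases}u_{{\rm head},C}(x),&x\in[-\ell_C,\ell_C],\\ u_{\rm cusp}(|x|-\ell_C),&|x|>\ell_C,\end{cases}$$ where $u=u_{{\rm head},C}(x)\in[1,\sqrt{1+e^{2C}}]$ is defined by $\ell_C-|x|=\int_1^u\frac{d\xi}{\sqrt{2C-\log(\xi^2-1)}}$. *)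

(* Defs.v *)
From HB Require Import structures.
From mathcomp Require Import all_boot all_order all_algebra.
From mathcomp Require Import all_classical all_reals all_analysis.
Import Order.TTheory GRing.Theory Num.Theory.
Import numFieldNormedType.Exports.

Set Implicit Arguments.
Unset Strict Implicit.
Unset Printing Implicit Defensive.

Local Open Scope classical_set_scope.
Local Open Scope ring_scope.

(* All integrals are Lebesgue integrals.  The integrands below are genuine on
   the interior of the integration intervals; at the endpoints (a null set)
   they may take the conventional values [ln 0 = 0] and [0^-1 = 0].  The
   integrals defining the profiles are finite (the singularity at the upper
   endpoint of the head integral is of inverse square root type), so taking
   them real-valued loses nothing. *)

(* For [x != 0] the equation has exactly one solution [u] in (0, 1): the
   integral is continuous and strictly decreasing in [u], tends to +oo as
   [u -> 0+] (the integrand is equivalent to 1 / xi) and to 0 as [u -> 1-]. *)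
Definition u_cusp (R : realType) (x : R) : R :=
  if x == 0 then 1 else
  get [set u : R | 0 < u < 1 /\
    `|x| = \int[lebesgue_measure]_(xi in `[u, 1])
             (Num.sqrt (- ln (1 - xi ^+ 2)))^-1].

Definition head_int (R : realType) (C u : R) : R :=
  \int[lebesgue_measure]_(xi in `[1, u])
    (Num.sqrt (2 * C - ln (xi ^+ 2 - 1)))^-1.

Definition u_max (R : realType) (C : R) : R := Num.sqrt (1 + expR (2 * C)).

Definition ell (R : realType) (C : R) : R := head_int C (u_max C).

(* For [`|x| <= ell C] the equation has exactly one solution in
   [1, u_max C], since [head_int C] increases continuously and strictly from
   0 to [ell C] there. *)
Definition u_head (R : realType) (C x : R) : R :=
  get [set u : R | 1 <= u <= u_max C /\ ell C - `|x| = head_int C u].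

Definition u_sol (R : realType) (C x : R) : R :=
  if `|x| <= ell C then u_head C x else u_cusp (`|x| - ell C).

(* [psi_x] is the pointwise derivative, which suffices for the profiles above:
   they are continuous, and C^1 except at 0 for [u_cusp] and at +/- [ell C]
   for [u_sol C], and locally absolutely continuous, so that it agrees almost
   everywhere with the weak derivative.  The arbitrary value taken by
   [derive1 psi] at the exceptional points does not affect the integral. *)
Definition energy (R : realType) (psi : R -> R) : \bar R :=
  (\int[lebesgue_measure]_x (`|derive1 psi x| ^+ 2)%:E)%E.

(* Main.v *)
Require Import Defs.
From mathcomp Require Import all_boot all_order all_algebra.
From mathcomp Require Import all_classical all_reals all_analysis.
From mathcomp Require Import measurable_realfun.
Import Order.TTheory GRing.Theory Num.Theory.
Import numFieldNormedType.Exports.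

Set Implicit Arguments.
Unset Strict Implicit.
Unset Printing Implicit Defensive.

Local Open Scope classical_set_scope.
Local Open Scope ring_scope.

(** Outside [-ell C, ell C] the graph of [u_sol C] consists of the two halves
    of the cusped soliton, translated by [-ell C] and [ell C]; hence the energy
    of the tails of [u_sol C] is exactly that of the cusped soliton, and the
    head contributes a nonnegative amount.  To avoid proving the measurability
    of the profiles, the comparison is made on the simple functions below the
    integrands, whose integrals have the Lebesgue integral as supremum. *)

Section translation.
Context {R : realType}.
Local Notation mu := (@lebesgue_measure R).

Lemma measurable_shift (a : R) :
  measurable_fun [set: measurableTypeR R] (shift a : _ -> measurableTypeR R).
Proof. exact: measurable_funD. Qed.

(** Lebesgue measure is determined by its values on the intervals []b, c]], and the preimage of such
    an interval under a shift is an interval of the same length. *)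
Lemma lebesgue_measure_shift (a : R) (A : set (measurableTypeR R)) :
  measurable A ->
  mu A = pushforward mu (shift a : _ -> measurableTypeR R) A.
Proof.
move: A; apply: lebesgue_measure_unique => [|ma /= _ [[b c] _ <-]].
  exact: measurable_shift.
rewrite /pushforward.
have -> : shift a @^-1` `]b, c] = `]b - a, c - a]%classic.
  by apply/seteqP; split=> x /=; rewrite !in_itv /= ltrBlDr lerBrDr.
rewrite !lebesgue_measure_itv /= !lte_fin ltrD2r.
by case: ifPn => // _; rewrite -!EFinB opprB addrA subrK.
Qed.

Lemma ge0_integral_shift (a : R) (D : set (measurableTypeR R)) (f : R -> \bar R) :
  measurable D -> measurable_fun D f -> (forall x, 0 <= f x)%E ->
  (\int[mu]_(x in D) f x = \int[mu]_(x in shift a @^-1` D) f (x + a)%R)%E.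
Proof.
move=> mD mf f0.
rewrite -(ge0_integral_pushforward (measurable_shift a))//.
apply: eq_measure_integral => [|ms A mA _]; first exact: measurable_shift.
exact: lebesgue_measure_shift.
Qed.

End translation.

Section lower_integral.
Local Open Scope ereal_scope.
Context d (T : measurableType d) (R : realType).
Variable mu : {measure set T -> \bar R}.
Import HBNNSimple.

(** This unfolds the definition of the integral, which makes sense for every nonnegative [f],
    measurable or not. *)
Lemma ge0_integralE_sup (f : T -> \bar R) : (forall x, 0 <= f x) ->
  \int[mu]_x f x = ereal_sup [set \int[mu]_x (h x)%:E |
    h in [set h : {nnsfun T >-> R} | forall x, (h x)%:E <= f x]].
Proof.
move=> f0; rewrite ge0_integralTE//; congr ereal_sup.
by apply/seteqP; split=> _ [h hf <-]; exists h => //; rewrite integralT_nnsfun.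
Qed.

(** A simple function below [f] is also below [g], so the second supremum runs over a larger set. *)
Lemma ge0_le_integralT (f g : T -> \bar R) : (forall x, 0 <= f x) ->
  (forall x, f x <= g x) -> \int[mu]_x f x <= \int[mu]_x g x.
Proof.
move=> f0 fg; rewrite !ge0_integralE_sup//; last first.
  by move=> x; exact: le_trans (fg x).
by apply: le_ereal_sup => _ [h hf <-]; exists h => // x; exact: le_trans (fg x).
Qed.

End lower_integral.

Section spliced_translates.
Local Open Scope ereal_scope.
Context {R : realType}.
Local Notation mu := (@lebesgue_measure R).
Import HBNNSimple.

(** Cut [f] at 0 and move the two halves apart, each by [a]. As [0 <= a] they do not overlap, so
    their sum lies below [g] pointwise, while translation has preserved their integrals. *)
Lemma integral_le_spliced_measurable (a : R) (f g : R -> \bar R) : (0 <= a)%R ->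
  measurable_fun [set: measurableTypeR R] f ->
  (forall x, 0 <= f x) -> (forall x, 0 <= g x) ->
  (forall x, (a < x)%R -> f (x - a)%R <= g x) ->
  (forall x, (x < - a)%R -> f (x + a)%R <= g x) ->
  \int[mu]_x f x <= \int[mu]_x g x.
Proof.
move=> a0 mf f0 g0 fr fl.
have mfD D : measurable_fun D f by exact: measurable_funS mf.
have mfs b (D : set R) : measurable_fun D (fun x : R => f (x + b)%R).
  exact: measurable_funS (measurableT_comp mf (measurable_shift b)).
have IfE : \int[mu]_x f x =
    \int[mu]_(x in `]-oo, 0%R[) f x + \int[mu]_(x in `]0%R, +oo[) f x.
  have -> : [set: R] = `]-oo, 0%R] `|` `]0%R, +oo[.
    apply/seteqP; split=> x // _.
    by rewrite /= !in_itv/= andbT; apply/orP; case: leP.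
  (* The point 0 is a null set, so the closed end of the left half-line may be opened. *)
  rewrite ge0_integral_setU//; first by rewrite integral_itv_bndo_bndc.
    exact: mfD.
  rewrite disj_set2E; apply/eqP/seteqP; split=> // x [] /=.
  by rewrite !in_itv/= andbT leNgt => /negP.
rewrite IfE (ge0_integral_shift a _ (mfD `]-oo, 0%R[%classic))//.
rewrite (ge0_integral_shift (- a)%R _ (mfD `]0%R, +oo[%classic))//.
have -> : shift a @^-1` `]-oo, 0%R[ = `]-oo, (- a)%R[%classic.
  by apply/seteqP; split=> x /=; rewrite !in_itv/= -ltrBrDr sub0r.
have -> : shift (- a)%R @^-1` `]0%R, +oo[ = `]a, +oo[%classic.
  by apply/seteqP; split=> x /=; rewrite !in_itv/= !andbT subr_gt0.
(* Extending both halves by zero to the whole line turns the sum of integrals into the integral of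
   one function, to be compared with [g] pointwise. *)
rewrite [X in X + _]integral_mkcond [X in _ + X]integral_mkcond.
rewrite -ge0_integralD//; last 4 first.
- by move=> x _; exact: erestrict_ge0.
- apply: (measurable_restrictT _ _).1 => //; exact: mfs.
- by move=> x _; exact: erestrict_ge0.
- apply: (measurable_restrictT _ _).1 => //; exact: mfs.
apply: ge0_le_integralT => x; first by rewrite adde_ge0// erestrict_ge0.
rewrite !patchE !mem_setE !in_itv/= andbT.
have [xa|xa] := boolP (x < - a)%R.
  rewrite ifF ?adde0; first exact: fl.
  apply/negbTE; rewrite -leNgt (le_trans (ltW xa))//.
  by rewrite (le_trans _ a0)// oppr_le0.
by rewrite add0e; case: ifPn => // /fr.
Qed.

(** Each simple function [h <= f] is measurable and inherits the two tail inequalities from [f]; the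
    supremum over [h] gives the claim. *)
Lemma integral_le_spliced (a : R) (f g : R -> \bar R) : (0 <= a)%R ->
  (forall x, 0 <= f x) -> (forall x, 0 <= g x) ->
  (forall x, (a < x)%R -> f (x - a)%R <= g x) ->
  (forall x, (x < - a)%R -> f (x + a)%R <= g x) ->
  \int[mu]_x f x <= \int[mu]_x g x.
Proof.
move=> a0 f0 g0 fr fl; rewrite ge0_integralE_sup//.
apply: ge_ereal_sup => _ [h hf <-].
apply: (integral_le_spliced_measurable a0) => //.
- exact/measurable_EFinP/measurable_funP.
- by move=> x; rewrite lee_fin.
- by move=> x /fr; exact: le_trans.
- by move=> x /fl; exact: le_trans.
Qed.

End spliced_translates.

(** The difference quotients agree near 0, hence so do their limits, default values included. *)
Lemma near_eq_derive1 (R : realType) (f g : R -> R) (x : R) :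
  (\near x, f x = g x) -> derive1 f x = derive1 g x.
Proof. by move=> fg; rewrite !derive1E; apply: near_eq_derive. Qed.

Lemma derive1_comp_shift (R : realType) (f : R -> R) (a x : R) :
  derive1 (f \o shift a) x = derive1 f (x + a).
Proof.
by rewrite /derive1; under [in RHS]eq_fun do rewrite addrA.
Qed.

Lemma u_cuspN (R : realType) (x : R) : u_cusp (- x) = u_cusp x.
Proof. by rewrite /u_cusp oppr_eq0 normrN. Qed.

Lemma ell_ge0 (R : realType) (C : R) : 0 <= ell C.
Proof. by apply: Rintegral_ge0 => x _; rewrite invr_ge0 sqrtr_ge0. Qed.

Lemma derive1_u_sol_right (R : realType) (C x : R) : ell C < x ->
  derive1 (u_sol C) x = derive1 (@u_cusp R) (x - ell C).
Proof.
move=> ltx; rewrite -derive1_comp_shift; apply: near_eq_derive1.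
near=> y; have lty : ell C < y by near: y; exact: lt_nbhsr.
have y0 : 0 < y by exact: le_lt_trans (ell_ge0 C) lty.
by rewrite /u_sol gtr0_norm// leNgt lty.
Unshelve. all: by end_near. Qed.

Lemma derive1_u_sol_left (R : realType) (C x : R) : x < - ell C ->
  derive1 (u_sol C) x = derive1 (@u_cusp R) (x + ell C).
Proof.
move=> ltx; rewrite -derive1_comp_shift; apply: near_eq_derive1.
near=> y; have lty : y < - ell C by near: y; exact: lt_nbhsl.
have y0 : y < 0 by rewrite (lt_le_trans lty)// oppr_le0 ell_ge0.
(* Here [|y| - ell C] is [- (y + ell C)], and the cusped soliton is even. *)
by rewrite /u_sol ltr0_norm// leNgt ltrNr lty/= -opprD u_cuspN.
Unshelve. all: by end_near. Qed.

Theorem mainTheorem10 (R : realType) (C : R) :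
  (energy (@u_cusp R) <= energy (u_sol C))%E.
Proof.
(* Both tail inequalities hold with equality; on the head only nonnegativity of the integrand
   enters. *)
apply: (integral_le_spliced (ell_ge0 C)) => x.
- by rewrite lee_fin exprn_ge0.
- by rewrite lee_fin exprn_ge0.
- by move=> /derive1_u_sol_right ->.
- by move=> /derive1_u_sol_left ->.
Qed.
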